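(* Let $\mathcal{N}$ be a power network description as in the context, with private line conductances $\mathbf{g}=(g_{ij})_{(i,j)\in E}\in\mathbb{R}^n$ and susceptances $\mathbf{b}=(b_{ij})_{(i,j)\in E}\in\mathbb{R}^n$. Fix $\alpha>0$, $\epsilon>0$, $\beta>0$ and $\lambda>0$. Then the Power Lines Obfuscation (PLO) mechanism described in the context, viewed as a randomized algorithm that maps the private line-parameter data to the released network description $\dot{\mathcal{N}}$, is $\epsilon$-differentially private with respect to the $\alpha$-indistinguishability adjacency relation.
   Context: Network data: a set of buses $N$ ($|N|=m$), a set $E$ of $n$ directed lines (transmission lines and transformers) and the set $E^R$ of the same lines with reversed direction; each line has admittance $Y_{ij}=g_{ij}+\mathbf{i}\,b_{ij}$ (conductance $g_{ij}$, susceptance $b_{ij}$). The remaining network data (bus demands $S^d_i$, generator bounds $S^{gl}_i,S^{gu}_i$, voltage bounds $v^l_i,v^u_i$, phase-angle-difference limits $\theta^\Delta_{ij}$, thermal limits $s^u_{ij}$, generation cost coefficients $c_{0i},c_{1i},c_{2i}$, a slack bus $s$), the optimal AC-OPF dispatch cost $O^*>0$ of $\mathcal{N}$, the vector of conductance/susceptance ratios $\mathbf{r}=(r_{ij})_{(i,j)\in E}$, and the partition of lines by voltage level ($E(v)$ = lines at voltage level $v\in VL(\mathcal{N})$, $n_v=|E(v)|$, each line in exactly one $E(v)$) are public. Write $\mathrm{cost}(S^g_i)=c_{2i}(\Re S^g_i)^2+c_{1i}\Re S^g_i+c_{0i}$. Laplace distribution: $\mathrm{Lap}(\lambda')$ has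 density $\frac{1}{2\lambda'}e^{-|x|/\lambda'}$; $\mathrm{Lap}(\lambda')^n$ denotes $n$ i.i.d. draws. Differential privacy: two private datasets $D,D'$ (here the line-parameter vectors) are $\alpha$-adjacent, $D\sim_\alpha D'$, if there is a single coordinate $i$ with $|D_i-D'_i|\le\alpha$ and $D_j=D'_j$ for all $j\neq i$. A randomized algorithm $\mathcal{A}$ is $\epsilon$-differentially private if for all $D\sim_\alpha D'$ and all measurable output sets $O$, $\Pr[\mathcal{A}(D)\in O]\le e^{\epsilon}\Pr[\mathcal{A}(D')\in O]$. PLO mechanism (input $\mathcal{N},O^*,\epsilon,\alpha,\beta$; all noise draws independent): 1. $\tilde{\mathbf{g}}=\mathbf{g}+z$, $z\sim\mathrm{Lap}(3\alpha/\epsilon)^n$. 2. $\tilde b_{ij}=r_{ij}\tilde g_{ij}$ for each line. 3. For each voltage level $v$: $\tilde\mu^v_{\mathbf g}=\frac{1}{n_v}\sum_{(i,j)\in E(v)}g_{ij}+\mathrm{Lap}(3\alpha/(n_v\epsilon))$ and $\tilde\mu^v_{\mathbf b}=\frac{1}{n_v}\sum_{(i,j)\in E(v)}b_{ij}+\mathrm{Lap}(3\alpha/(n_v\epsilon))$. 4. Solve (selecting a solution by any fixed rule) the problem with variables $S^g_i,V_i$ ($i\in N$), $\dot Y_{ij}=\dot g_{ij}+\mathbf{i}\dot b_{ij}$ and $S_{ij}$ ($(i,j)\in E\cup E^R$): minimize $\|\dot{\mathbf g}-\tilde{\mathbf g}\|_2^2+\|\dot{\mathbf b}-\tilde{\mathbf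 b}\|_2^2$ subject to $\angle V_s=0$; $v^l_i\le|V_i|\le v^u_i$; $-\theta^\Delta_{ij}\le\angle(V_iV_j^* )\le\theta^\Delta_{ij}$ for $(i,j)\in E$; $S^{gl}_i\le S^g_i\le S^{gu}_i$; $|S_{ij}|\le s^u_{ij}$; $S^g_i-S^d_i=\sum_{(i,j)\in E\cup E^R}S_{ij}$; $\frac{|\sum_{i\in N}\mathrm{cost}(S^g_i)-O^*|}{O^*}\le\beta$; $S_{ij}=\dot Y^*_{ij}|V_i|^2-\dot Y^*_{ij}V_iV_j^*$; and for each $v$ and each line in $E(v)\cup E^R(v)$: $\tilde\mu^v_{\mathbf g}/\lambda\le\dot g_{ij}\le\lambda\tilde\mu^v_{\mathbf g}$, $\tilde\mu^v_{\mathbf b}/\lambda\le\dot b_{ij}\le\lambda\tilde\mu^v_{\mathbf b}$. Output: $\dot{\mathcal{N}}$, identical to $\mathcal{N}$ except that the admittances are replaced by $\dot Y$. *)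

(* Defs.v *)
From HB Require Import structures.
From mathcomp Require Import all_boot all_order all_algebra.
From mathcomp Require Import complex.
From mathcomp Require Import all_classical all_reals all_analysis.

Set Implicit Arguments.
Unset Strict Implicit.
Unset Printing Implicit Defensive.

Import Order.TTheory GRing.Theory Num.Theory.
Local Open Scope ring_scope.
Local Open Scope classical_set_scope.

(* Buses are 'I_m, (directed) lines of E are 'I_n, voltage levels are 'I_k. *)
(* A directed edge of E \cup E^R is a pair (e, rev) : 'I_n * bool, where     *)
(* (e, false) is the line e = (fbus e, tbus e) in E and (e, true) is its    *)
(* reversal (tbus e, fbus e) in E^R.                                        *)
Record pub_network (R : realType) (m n k : nat) := PubNetwork {
  fbus  : 'I_n -> 'I_m;
  tbus  : 'I_n -> 'I_m;
  Sd    : 'I_m -> R[i];          (* demand S^d_i *)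
  Sgl   : 'I_m -> R[i];          (* generation lower bound S^{gl}_i *)
  Sgu   : 'I_m -> R[i];          (* generation upper bound S^{gu}_i *)
  vl    : 'I_m -> R;             (* voltage magnitude lower bound *)
  vu    : 'I_m -> R;             (* voltage magnitude upper bound *)
  thD   : 'I_n -> R;             (* phase-angle-difference limit of (i,j) in E *)
  su    : 'I_n -> bool -> R;     (* thermal limit s^u of a directed edge *)
  c0    : 'I_m -> R;
  c1    : 'I_m -> R;
  c2    : 'I_m -> R;
  slack : 'I_m;
  ratio : 'I_n -> R;             (* r_ij = b_ij / g_ij (public) *)
  level : 'I_n -> 'I_k
}.

Section PLO.
Variables (R : realType) (m n k : nat) (N : pub_network R m n k).

Definition cmod (z : R[i]) : R := Normc.normc z.

Definition angle_in (z : R[i]) (lo hi : R) : Prop :=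
  exists t : R, lo <= t <= hi /\
    z = Complex (cmod z * cos t) (cmod z * sin t).

Definition cle (x y : R[i]) : Prop :=
  complex.Re x <= complex.Re y /\ complex.Im x <= complex.Im y.

Definition gen_cost (i : 'I_m) (Sg : R[i]) : R :=
  c2 N i * (complex.Re Sg) ^+ 2 + c1 N i * complex.Re Sg + c0 N i.

Definition lines_at (v : 'I_k) : {set 'I_n} := [set e | level N e == v].
Definition n_at (v : 'I_k) : nat := #|lines_at v|.

(* Constraints of the optimization problem of step 4, for candidate
   admittances Ydot_e = gd e + i bd e (the same admittance is used for both
   directions of a line), given the noisy level means mug, mub. *)
Definition plo_feasible (Ostar beta lam : R) (mug mub : 'I_k -> R)
    (gd bd : 'I_n -> R) : Prop :=
  exists (Sg V : 'I_m -> R[i]) (S : 'I_n -> bool -> R[i]),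
  let Y e := Complex (gd e) (bd e) in
  angle_in (V (slack N)) 0 0 /\
      (forall i, vl N i <= cmod (V i) <= vu N i) /\
      (forall e, angle_in (V (fbus N e) * conjc (V (tbus N e)))
                          (- thD N e) (thD N e)) /\
      (forall i, cle (Sgl N i) (Sg i) /\ cle (Sg i) (Sgu N i)) /\
      (forall e r, cmod (S e r) <= su N e r) /\
      (forall i, Sg i - Sd N i =
          \sum_(e | fbus N e == i) S e false + \sum_(e | tbus N e == i) S e true) /\
      `|\sum_i gen_cost i (Sg i) - Ostar| / Ostar <= beta /\
      (forall e,
          S e false = conjc (Y e) * Complex (cmod (V (fbus N e)) ^+ 2) 0
                      - conjc (Y e) * V (fbus N e) * conjc (V (tbus N e)) /\
          S e true  = conjc (Y e) * Complex (cmod (V (tbus N e)) ^+ 2) 0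
                      - conjc (Y e) * V (tbus N e) * conjc (V (fbus N e))) /\
      (forall e, mug (level N e) / lam <= gd e <= lam * mug (level N e) /\
                 mub (level N e) / lam <= bd e <= lam * mub (level N e)).

(* objective ||gd - gt||^2 + ||bd - bt||^2 with bt_e = r_e * gt_e *)
Definition plo_obj (gt gd bd : 'I_n -> R) : R :=
  \sum_e ((gd e - gt e) ^+ 2 + (bd e - ratio N e * gt e) ^+ 2).

Definition plo_optimal (Ostar beta lam : R) (gt : 'I_n -> R)
    (mug mub : 'I_k -> R) (gd bd : 'I_n -> R) : Prop :=
  plo_feasible Ostar beta lam mug mub gd bd /\
  forall gd' bd', plo_feasible Ostar beta lam mug mub gd' bd' ->
    plo_obj gt gd bd <= plo_obj gt gd' bd'.

(* Noisy inputs of step 4: (g~, (mu~_g, mu~_b)), as tuples (product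
   sigma-algebra); outputs: (gdot, bdot). *)
Definition noisy_in := (n.-tuple R * (k.-tuple R * k.-tuple R))%type.
Definition plo_out := (n.-tuple R * n.-tuple R)%type.

Definition selection_rule (Ostar beta lam : R) (sel : noisy_in -> plo_out)
  : Prop :=
  forall x : noisy_in,
    let gt e := tnth x.1 e in
    let mug v := tnth x.2.1 v in
    let mub v := tnth x.2.2 v in
    (exists gd bd, plo_optimal Ostar beta lam gt mug mub gd bd) ->
    plo_optimal Ostar beta lam gt mug mub
      (fun e => tnth (sel x).1 e) (fun e => tnth (sel x).2 e).

End PLO.

Section Prob.
Variables (R : realType) (d : measure_display) (T : measurableType d)
  (P : probability T R).

Definition laplace_rv (lam' : R) (X : {RV P >-> R}) : Prop :=
  forall B : set R, measurable B ->
    P (X @^-1` B) =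
    (\int[lebesgue_measure]_(x in B) ((2 * lam')^-1 * expR (- `|x| / lam'))%:E)%E.

Definition mutually_independent (I : finType) (X : I -> {RV P >-> R}) : Prop :=
  forall B : I -> set R, (forall i, measurable (B i)) ->
    P (\bigcap_i (X i @^-1` B i)) = (\prod_(i : I) P (X i @^-1` B i))%E.

End Prob.

(* Noise index: inl e  -> z_e      ~ Lap(3 alpha / eps)         (step 1)     *)
(*              inr (inl v) -> noise of mu~^v_g ~ Lap(3 alpha/(n_v eps))     *)
(*              inr (inr v) -> noise of mu~^v_b ~ Lap(3 alpha/(n_v eps))     *)
Definition noise_idx (n k : nat) := ('I_n + ('I_k + 'I_k))%type.

Definition level_mean (R : realType) (m n k : nat) (N : pub_network R m n k)
    (x : 'I_n -> R) (v : 'I_k) : R :=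
  (n_at N v)%:R^-1 * \sum_(e in lines_at N v) x e.

Definition plo_noise_scale (R : realType) (m n k : nat)
    (N : pub_network R m n k) (alpha eps : R) (j : noise_idx n k) : R :=
  match j with
  | inl _ => 3 * alpha / eps
  | inr (inl v) | inr (inr v) => 3 * alpha / ((n_at N v)%:R * eps)
  end.

Definition plo_output (R : realType) (m n k : nat) (N : pub_network R m n k)
    (sel : noisy_in R n k -> plo_out R n)
    (d : measure_display) (T : measurableType d) (P : probability T R)
    (Z : noise_idx n k -> {RV P >-> R}) (g b : 'I_n -> R) (w : T)
  : plo_out R n :=
  sel ( [tuple g e + Z (inl e) w | e < n],
        ([tuple level_mean N g v + Z (inr (inl v)) w | v < k],
         [tuple level_mean N b v + Z (inr (inr v)) w | v < k]) ).

Definition alpha_adjacent (R : realType) (n : nat) (alpha : R)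
    (D D' : ('I_n -> R) * ('I_n -> R)) : Prop :=
  exists e : 'I_n,
    `|D.1 e - D'.1 e| <= alpha /\ `|D.2 e - D'.2 e| <= alpha /\
    forall e', e' != e -> D.1 e' = D'.1 e' /\ D.2 e' = D'.2 e'.

(* Main.v *)
(** The optimisation of step 4 only sees the noisy vector [Z + s(D)], so it is
    post-processing, and it suffices to compare the laws of [Z + s(D)] and
    [Z + s(D')]. Translating one Laplace coordinate of scale [l] by [t]
    multiplies its density by at most [exp (|t| / l)]; by independence the same
    factor bounds the joint law (replace that coordinate by an independent copy
    and apply Fubini), and moving one coordinate at a time gives the factor
    [exp (sum_i |s_i(D) - s_i(D')| / l_i)]. Changing one line by [alpha] moves
    one conductance by [alpha] and the two means of its voltage level by
    [alpha / n_v], so each of the three noise families contributes [eps / 3]. *)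

Require Import Defs.
From HB Require Import structures.
From mathcomp Require Import all_boot all_order all_algebra.
From mathcomp Require Import complex.
From mathcomp Require Import all_classical all_reals all_analysis.
From mathcomp Require Import measurable_realfun ring.

Set Implicit Arguments.
Unset Strict Implicit.
Unset Printing Implicit Defensive.

Import Order.TTheory GRing.Theory Num.Theory.
Local Open Scope ring_scope.
Local Open Scope classical_set_scope.

(** * Translations of the line and the Laplace density *)

Lemma measurable_addr (R : realType) (c : R) :
  measurable_fun [set: R] (fun x : R => x + c).
Proof. exact: measurable_funD. Qed.

(** Lebesgue measure is determined by its values on half-open intervals, and a translation preserves
    their lengths. *)
Lemma lebesgue_measure_shift (R : realType) (c : R) (A : set R) :
  measurable A ->
  pushforward lebesgue_measure ((fun x => x + c) : R -> measurableTypeR R) A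
  = lebesgue_measure A.
Proof.
move=> mA; apply/esym.
pose m := pushforward lebesgue_measure ((fun x => x + c) : R -> measurableTypeR R).
apply: (@lebesgue_measure_unique R m) => //=.
  exact: measurable_addr.
move=> _ _ [[a b]] _ <-.
transitivity (lebesgue_measure (`](a - c), (b - c)]%classic : set R)); last first.
  congr lebesgue_measure; apply/seteqP; split=> x /=;
  by rewrite !in_itv/= ltrBlDr lerBrDr.
rewrite !lebesgue_measure_itv/= !lte_fin ltrD2r; case: ifP => // _.
by rewrite -!EFinB; congr EFin; rewrite opprB addrA subrK.
Qed.

(** Change of variables [y = x + c], read off from the integral against a pushforward measure. *)
Lemma ge0_integral_shift (R : realType) (c : R) (B : set R) (f : R -> \bar R) :
  measurable B -> measurable_fun [set: R] f -> (forall x, 0 <= f x)%E ->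
  (\int[lebesgue_measure]_(x in (fun x => x + c)%R @^-1` B) f x =
   \int[lebesgue_measure]_(y in B) f (y - c)%R)%E.
Proof.
move=> mB mf f0.
have mfc : measurable_fun B (fun y => f (y - c)).
  apply: measurable_funTS.
  by apply: (measurableT_comp mf); exact: measurable_addr.
transitivity (\int[pushforward lebesgue_measure
    ((fun x => x + c)%R : R -> measurableTypeR R)]_(y in B) f (y - c)%R)%E; last first.
  apply: eq_measure_integral; first exact: measurable_addr.
  by move=> ? A mA _; exact: lebesgue_measure_shift.
rewrite ge0_integral_pushforward//=; last exact: measurable_addr.
by apply: eq_integral => x _ /=; rewrite addrK.
Qed.

Definition laplace_pdf (R : realType) (l : R) (x : R) : R :=
  (2 * l)^-1 * expR (- `|x| / l).

Lemma laplace_pdf_ge0 (R : realType) (l x : R) : 0 < l -> 0 <= laplace_pdf l x.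
Proof.
by move=> l0; rewrite mulr_ge0 ?expR_ge0// invr_ge0 mulr_ge0// ltW.
Qed.

Lemma measurable_laplace_pdf (R : realType) (l : R) :
  measurable_fun [set: R] (fun x => (laplace_pdf l x)%:E).
Proof.
apply/measurable_EFinP; apply: measurable_funM => //.
apply: measurableT_comp => //; apply: measurable_funM => //.
by apply: measurableT_comp => //; exact: measurableT_comp.
Qed.

(** The triangle inequality [|y - b| <= |y - a| + |a - b|], taken into the exponent. *)
Lemma laplace_pdf_shift_le (R : realType) (l a b y : R) : 0 < l ->
  laplace_pdf l (y - a) <= expR (`|a - b| / l) * laplace_pdf l (y - b).
Proof.
move=> l0; rewrite /laplace_pdf [leRHS]mulrCA.
apply: ler_wpM2l; first by rewrite invr_ge0 mulr_ge0// ltW.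
rewrite -expRD ler_expR -mulrDl; apply: ler_wpM2r; first by rewrite invr_ge0 ltW.
have := ler_normD (y - a) (a - b); rewrite addrA subrK => h.
by rewrite lerBrDr [leLHS]addrC lerBlDr [leRHS]addrC.
Qed.

Lemma laplace_shift_le (R : realType) (d : measure_display)
    (T : measurableType d) (P : probability T R) (X : {RV P >-> R})
    (l a b : R) (C : set R) : 0 < l -> laplace_rv l X -> measurable C ->
  (P (X @^-1` [set x | C (x + a)%R])
   <= (expR (`|a - b| / l))%:E * P (X @^-1` [set x | C (x + b)%R]))%E.
Proof.
move=> l0 lapX mC.
have mS c : measurable [set x | C (x + c)].
  by rewrite -[X in measurable X]setTI; exact: measurable_addr.
have lawE c : P (X @^-1` [set x | C (x + c)]) =
    (\int[lebesgue_measure]_(y in C) (laplace_pdf l (y - c)%R)%:E)%E.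
  rewrite lapX// -[RHS](@ge0_integral_shift R c C
    (fun x => (laplace_pdf l x)%:E))//.
  - exact: measurable_laplace_pdf.
  - by move=> x; rewrite lee_fin laplace_pdf_ge0.
have mp c : measurable_fun C (fun y => (laplace_pdf l (y - c))%:E).
  apply: measurable_funTS.
  apply: (measurableT_comp (measurable_laplace_pdf l)).
  exact: measurable_addr.
have p0 c y : (0 <= (laplace_pdf l (y - c)%R)%:E)%E.
  by rewrite lee_fin laplace_pdf_ge0.
rewrite !lawE -ge0_integralZl//; last exact: mp.
apply: ge0_le_integral => //.
- exact: mp.
- exact: (measurable_funeM _ (mp b)).
- by move=> y _; rewrite -EFinM lee_fin laplace_pdf_shift_le.
Qed.

(** * The product sigma-algebra on finite families of reals *)

Section boxes.
Context (R : realType) (I : finType).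

Definition coordType := I -> R.
HB.instance Definition _ := gen_eqMixin coordType.
HB.instance Definition _ := gen_choiceMixin coordType.
HB.instance Definition _ := isPointed.Build coordType (fun=> 0).

Definition box (B : I -> set R) : set coordType :=
  [set f | forall i, B i (f i)].

Definition boxes : set (set coordType) :=
  [set box B | B in [set B : I -> set R | forall i, measurable (B i)]].

(** Boxes serve as generators because [mutually_independent] prescribes probabilities on exactly
    these sets. *)
Definition boxType := g_sigma_algebraType boxes.

Lemma boxesT : boxes setT.
Proof. by exists (fun=> setT) => //; apply/seteqP; split. Qed.

Lemma boxesI : setI_closed boxes.
Proof.
move=> _ _ [B mB <-] [C mC <-]; exists (fun i => B i `&` C i).
  by move=> i; exact: measurableI.
apply/seteqP; split=> f /= h; last by case: h => hB hC i; split.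
by split=> i; case: (h i).
Qed.

Lemma measurable_box_coord (i : I) :
  measurable_fun [set: boxType] (fun f : boxType => f i).
Proof.
move=> _ A mA; rewrite setTI; apply: sub_sigma_algebra.
exists (fun j => if j == i then A else setT) => [j|]; first by case: ifP.
apply/seteqP; split=> f /= h; first by have := h i; rewrite eqxx.
by move=> j; case: eqP => [->|].
Qed.

Lemma measurable_fun_box (d : measure_display) (T : measurableType d)
    (f : T -> boxType) :
  (forall i, measurable_fun [set: T] (fun w => f w i)) ->
  measurable_fun [set: T] f.
Proof.
move=> mf; apply: (@measurability _ _ T boxType setT f boxes) => //.
move=> _ [_ [B mB <-] <-].
have -> : [set: T] `&` f @^-1` box B =
    \bigcap_(i in [set: I]) ([set: T] `&` (fun w => f w i) @^-1` B i).
  apply/seteqP; split=> w /= h; last by split=> // i; case: (h i Logic.I).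
  by move=> i _; split=> //; case: h => _; exact.
by apply: fin_bigcap_measurable => // i _; exact: mf.
Qed.

(** Boxes form a pi-system containing the whole space, so the uniqueness theorem for finite measures
    applies. *)
Lemma box_measure_unique (m1 m2 : {measure set boxType -> \bar R}) :
  (forall B : I -> set R, (forall i, measurable (B i)) ->
     m1 (box B) = m2 (box B)) ->
  (m1 setT < +oo)%E ->
  forall A : set boxType, measurable A -> m1 A = m2 A.
Proof.
move=> m12 m1T A mA.
apply: (@measure_unique _ R boxType boxes (fun=> setT)) => //.
- exact: boxesI.
- by move=> _; exact: boxesT.
- by apply/seteqP; split=> // x _; exists 0%N.
- by move=> _ [B mB <-]; exact: m12.
Qed.

End boxes.

(** * Shifting a vector of independent Laplace variables *)

Section independent_coordinates.
Context (R : realType) (d : measure_display) (T : measurableType d)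
  (P : probability T R) (I : finType) (Z : I -> {RV P >-> R}).
Hypothesis Zind : mutually_independent Z.

Definition joint (w : T) : boxType R I := fun i => Z i w.

(** Coordinate [j] gets its own real variable, so that Fubini can integrate it apart from the sample
    point. *)
Definition replace_coord (j : I) (p : R * T) : boxType R I :=
  fun i => if i == j then p.1 else Z i p.2.

Lemma measurable_joint : measurable_fun [set: T] joint.
Proof. by apply: measurable_fun_box => i; exact: measurable_funP. Qed.

Lemma measurable_replace_coord j :
  measurable_fun [set: R * T] (replace_coord j).
Proof.
apply: measurable_fun_box => i; rewrite /replace_coord.
case: (i == j); first exact: measurable_fst.
exact: (measurableT_comp (measurable_funP (Z i)) measurable_snd).
Qed.

Lemma joint_law_replace_coord j (A : set (boxType R I)) : measurable A ->
  P (joint @^-1` A) =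
  (distribution P (Z j) \x^ P)%E (replace_coord j @^-1` A).
Proof.
pose m1 := pushforward P joint.
pose m2 := pushforward (distribution P (Z j) \x^ P)%E (replace_coord j).
move: A; apply: (@box_measure_unique R I m1 m2).
- exact: measurable_joint.
- exact: measurable_replace_coord.
- move=> ? ? B mB.
  have E1 (C : I -> set R) : joint @^-1` box C = \bigcap_i (Z i @^-1` C i).
    by apply/seteqP; split=> w /= h i; [move=> _; exact: h|exact: (h i Logic.I)].
  (* Freeing coordinate [j] isolates the event on the other variables; its own factor becomes
     [P setT], which is 1. *)
  pose B' i := if i == j then setT else B i.
  have mB' i : measurable (B' i) by rewrite /B'; case: ifP.
  have E2 : replace_coord j @^-1` box B =
      B j `*` \bigcap_i (Z i @^-1` B' i).
    rewrite -E1; apply/seteqP; split=> -[x w] /=.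
      move=> h; split; first by have := h j; rewrite /replace_coord/= eqxx.
      move=> i; have := h i; rewrite /replace_coord/= /B' /joint.
      by case: eqP.
    move=> [Bx h] i; have := h i; rewrite /replace_coord/= /B' /joint.
    by case: eqP => // ->.
  have mcap : measurable (\bigcap_i (Z i @^-1` B' i)).
    apply: fin_bigcap_measurable => // i _.
    by rewrite -[X in measurable X]setTI; exact: measurable_funP.
  transitivity ((distribution P (Z j) \x^ P)%E
      (B j `*` \bigcap_i (Z i @^-1` B' i))); last by rewrite -E2.
  transitivity (P (joint @^-1` box B)) => //.
  rewrite product_measure2E// E1 (Zind mB) (bigD1 j)//=.
  transitivity (P (Z j @^-1` B j) * P (\bigcap_i (Z i @^-1` B' i)))%E => //.
  rewrite (Zind mB') [in RHS](bigD1 j)//=; congr (_ * _)%E.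
  rewrite {1}/B' eqxx preimage_setT probability_setT mul1e.
  by apply: eq_bigr => i ij; rewrite /B' (negbTE ij).
- by move=> ?; rewrite -[ltLHS]/(P setT) probability_setT ltry.
Qed.

Lemma measurable_shift (s : I -> R) :
  measurable_fun [set: boxType R I]
    (fun f : boxType R I => (fun i => f i + s i) : boxType R I).
Proof.
apply: measurable_fun_box => i.
apply: (measurableT_comp (measurable_addr (s i))).
exact: measurable_box_coord.
Qed.

Variable l : I -> R.
Hypotheses (l_gt0 : forall i, 0 < l i) (Zlap : forall i, laplace_rv (l i) (Z i)).

Lemma laplace_shift_coord (j : I) (s s' : I -> R) (A : set (boxType R I)) :
  measurable A -> (forall i, i != j -> s i = s' i) ->
  (P [set w | A (fun i => Z i w + s i)%R] <=
   (expR (`|s j - s' j| / l j))%:E * P [set w | A (fun i => Z i w + s' i)%R])%E.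
Proof.
move=> mA ss'.
pose tr (t : I -> R) (f : boxType R I) : boxType R I := fun i => f i + t i.
have mtr t : measurable (tr t @^-1` A).
  by rewrite -[X in measurable X]setTI; exact: measurable_shift.
have mrep t : measurable (replace_coord j @^-1` (tr t @^-1` A)).
  by rewrite -[X in measurable X]setTI; exact: measurable_replace_coord.
have PE t : P [set w | A (fun i => Z i w + t i)%R] =
    (\int[P]_w distribution P (Z j)
       (ysection (replace_coord j @^-1` (tr t @^-1` A)) w))%E.
  by rewrite -[LHS]/(P (joint @^-1` (tr t @^-1` A))) (joint_law_replace_coord j).
have mint t : measurable_fun [set: T] (fun w => distribution P (Z j)
       (ysection (replace_coord j @^-1` (tr t @^-1` A)) w)).
  exact: (measurable_fun_ysection (distribution P (Z j))).
rewrite !PE -ge0_integralZl//.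
apply: ge0_le_integral => //.
  exact: measurable_funeM.
move=> w _.
(* As [s] and [s'] agree off [j], a single [put] describes both sections: they are translates of one
   real set, by [s j] and [s' j]. *)
pose put (y : R) : boxType R I := fun i => if i == j then y else Z i w + s i.
have mput : measurable (put @^-1` A).
  rewrite -[X in measurable X]setTI; apply: measurable_fun_box => // i.
  by rewrite /put; case: (i == j).
have secE t : (forall i, i != j -> s i = t i) ->
    ysection (replace_coord j @^-1` (tr t @^-1` A)) w =
    [set x | (put @^-1` A) (x + t j)].
  move=> st; apply/seteqP.
  suff E x : tr t (replace_coord j (x, w)) = put (x + t j).
    by split=> x; rewrite /ysection /= inE /= E.
  apply/funext => i; rewrite /tr /replace_coord /put /=.
  by have [->//|ij] := eqVneq i j; rewrite st.
rewrite !secE//.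
exact: (@laplace_shift_le _ _ _ _ (Z j) _ _ _ _ (l_gt0 j) (Zlap j) mput).
Qed.

(** A hybrid argument: coordinates pass from [s] to [s'] one by one, and the factors multiply. *)
Lemma laplace_shift (s s' : I -> R) (A : set (boxType R I)) : measurable A ->
  (P [set w | A (fun i => Z i w + s i)%R] <=
   (expR (\sum_i `|s i - s' i| / l i))%:E *
     P [set w | A (fun i => Z i w + s' i)%R])%E.
Proof.
move=> mA.
(* Vacuous for the full enumeration; it is the invariant for induction on the list of coordinates
   still to be moved. *)
have : forall i, i \notin index_enum I -> s i = s' i.
  by move=> i; rewrite mem_index_enum.
elim: (index_enum I) (index_enum_uniq I) s => [|j r IH] /=.
  move=> _ s ss'; rewrite big_nil expR0 mul1e.
  by rewrite (_ : s = s')//; apply/funext => i; exact: ss'.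
move=> /andP[jr ur] s ss'.
pose t i := if i == j then s' i else s i.
have tr i : i \notin r -> t i = s' i.
  by move=> ir; rewrite /t; case: eqVneq => // ij; rewrite ss'// inE negb_or ij.
have := @laplace_shift_coord j s t A mA.
rewrite {1 2}/t eqxx => /(_ _)/le_trans; apply.
  by move=> i ij; rewrite /t (negbTE ij).
rewrite big_cons expRD EFinM -muleA lee_pmul2l//; last by rewrite lte_fin expR_gt0.
apply: le_trans (IH ur t tr) _.
(* The enumeration has no duplicates, so [j] is not in [r] and [t] equals [s] there. *)
rewrite (eq_big_seq (fun i => `|s i - s' i| / l i))// => i ir.
by rewrite /t; case: eqVneq => // ij; rewrite -ij ir in jr.
Qed.

End independent_coordinates.

(** * Sensitivity of conductances and level means to one line *)

Section sensitivity.
Context (R : realType) (m n k : nat) (N : pub_network R m n k).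
Variables (e0 : 'I_n) (x x' : 'I_n -> R).
Hypothesis xx' : forall e, e != e0 -> x e = x' e.

Lemma level_mean_eq v : v != level N e0 -> level_mean N x v = level_mean N x' v.
Proof.
move=> vl; congr (_ * _); apply: eq_bigr => e; rewrite inE => /eqP le.
by apply: xx'; apply: contraNneq vl => <-; rewrite le.
Qed.

Lemma level_mean_sub :
  level_mean N x (level N e0) - level_mean N x' (level N e0) =
  (n_at N (level N e0))%:R^-1 * (x e0 - x' e0).
Proof.
rewrite /level_mean -mulrBr; congr (_ * _).
have e0l : e0 \in lines_at N (level N e0) by rewrite inE.
rewrite (bigD1 e0)//= [in X in _ - X](bigD1 e0)//=.
rewrite (eq_bigr x'); last by move=> e /andP[_ /xx'].
by rewrite opprD addrACA subrr addr0.
Qed.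

Variables (alpha eps : R).
Hypotheses (alpha_gt0 : 0 < alpha) (eps_gt0 : 0 < eps).
Hypothesis x_close : `|x e0 - x' e0| <= alpha.

Lemma third_budget : alpha / (3 * alpha / eps) = eps / 3.
Proof.
by field; rewrite !gt_eqF.
Qed.

Lemma sum_line_shift_le :
  \sum_e `|x e - x' e| / (3 * alpha / eps) <= eps / 3.
Proof.
rewrite (bigD1 e0)//= big1 ?addr0 => [|e ee0]; last first.
  by rewrite xx'// subrr normr0 mul0r.
by rewrite -third_budget ler_wpM2r// invr_ge0 divr_ge0// ?mulr_ge0// ltW//.
Qed.

Lemma sum_level_shift_le : (0 < n_at N (level N e0))%N ->
  \sum_v `|level_mean N x v - level_mean N x' v| /
    (3 * alpha / ((n_at N v)%:R * eps)) <= eps / 3.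
Proof.
move=> nv; rewrite (bigD1 (level N e0))//= big1 ?addr0 => [|v vl]; last first.
  by rewrite level_mean_eq// subrr normr0 mul0r.
rewrite level_mean_sub; set c := (n_at _ _)%:R; have c0 : 0 < c by rewrite ltr0n.
(* The [1/c] in the change of the mean cancels the [1/c] in its noise scale, leaving the ratio of a
   single line. *)
have -> : `|c^-1 * (x e0 - x' e0)| / (3 * alpha / (c * eps)) =
    `|x e0 - x' e0| / (3 * alpha / eps).
  by rewrite normrM gtr0_norm ?invr_gt0//; field; rewrite !gt_eqF.
by rewrite -third_budget ler_wpM2r// invr_ge0 divr_ge0// ?mulr_ge0// ltW//.
Qed.

End sensitivity.

(** * The mechanism as post-processing of shifted noise *)

Definition noisy_of (R : realType) (n k : nat)
    (f : boxType R ('I_n + ('I_k + 'I_k))%type) : noisy_in R n k :=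
  ([tuple f (inl e) | e < n],
   ([tuple f (inr (inl v)) | v < k], [tuple f (inr (inr v)) | v < k])).

Lemma measurable_noisy_of (R : realType) (n k : nat) :
  measurable_fun setT (@noisy_of R n k).
Proof.
have mtup p (c : 'I_p -> 'I_n + ('I_k + 'I_k)) :
    measurable_fun [set: boxType R ('I_n + ('I_k + 'I_k))%type]
      (fun f => [tuple f (c i) | i < p]).
  apply/measurable_fun_tnthP => i.
  rewrite (_ : _ \o _ = fun f : boxType R _ => f (c i)).
    exact: measurable_box_coord.
  by apply/funext => f /=; rewrite tnth_mktuple.
apply: measurable_fun_pair; first exact: mtup.
by apply: measurable_fun_pair; exact: mtup.
Qed.

Definition plo_shift (R : realType) (m n k : nat) (N : pub_network R m n k)
    (D : ('I_n -> R) * ('I_n -> R)) (j : noise_idx n k) : R :=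
  match j with
  | inl e => D.1 e
  | inr (inl v) => level_mean N D.1 v
  | inr (inr v) => level_mean N D.2 v
  end.

(** Nonempty levels matter here: division by zero yields zero, so an empty level would have noise
    scale 0. *)
Lemma plo_noise_scale_gt0 (R : realType) (m n k : nat)
    (N : pub_network R m n k) (alpha eps : R) (j : noise_idx n k) :
  0 < alpha -> 0 < eps -> (forall v : 'I_k, (0 < n_at N v)%N) ->
  0 < plo_noise_scale N alpha eps j.
Proof.
by move=> a0 e0 nv; case: j => [e|[v|v]] /=;
  rewrite divr_gt0 ?mulr_gt0 ?ltr0n.
Qed.

Lemma plo_shift_le (R : realType) (m n k : nat) (N : pub_network R m n k)
    (alpha eps : R) (D D' : ('I_n -> R) * ('I_n -> R)) :
  0 < alpha -> 0 < eps -> (forall v : 'I_k, (0 < n_at N v)%N) ->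
  alpha_adjacent alpha D D' ->
  \sum_j `|plo_shift N D j - plo_shift N D' j| / plo_noise_scale N alpha eps j
    <= eps.
Proof.
move=> a0 eps0 nv [e0 [D1 [D2 Deq]]].
have D1eq e : e != e0 -> D.1 e = D'.1 e by move=> /Deq[].
have D2eq e : e != e0 -> D.2 e = D'.2 e by move=> /Deq[].
(* The sum splits into line noises, conductance means and susceptance means, each bounded by a third
   of [eps]. *)
rewrite big_sumType big_sumType /=.
rewrite [leRHS](_ : _ = eps / 3 + (eps / 3 + eps / 3)); last by field.
by rewrite lerD ?lerD// ?(sum_line_shift_le D1eq)//
  ?(sum_level_shift_le D1eq)// ?(sum_level_shift_le D2eq).
Qed.

(* Theorem 4: the PLO mechanism is eps-differentially private w.r.t.
   alpha-adjacency, for every alpha, eps, beta, lam > 0. *)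
Theorem theorem4 (R : realType) (m n k : nat) (N : pub_network R m n k)
    (Ostar alpha eps beta lam : R)
    (hO : 0 < Ostar) (ha : 0 < alpha) (he : 0 < eps) (hb : 0 < beta)
    (hl : 0 < lam)
    (hlev : forall v : 'I_k, (0 < n_at N v)%N)
    (sel : noisy_in R n k -> plo_out R n)
    (hsel : selection_rule N Ostar beta lam sel)
    (hselm : measurable_fun setT sel)
    (d : measure_display) (T : measurableType d) (P : probability T R)
    (Z : noise_idx n k -> {RV P >-> R})
    (hZind : mutually_independent Z)
    (hZlap : forall j, laplace_rv (plo_noise_scale N alpha eps j) (Z j)) :
  forall (D D' : ('I_n -> R) * ('I_n -> R)),
    alpha_adjacent alpha D D' ->
    forall O : set (plo_out R n), measurable O ->
      (P (plo_output N sel Z D.1 D.2 @^-1` O)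
       <= (expR eps)%:E * P (plo_output N sel Z D'.1 D'.2 @^-1` O))%E.
Proof.
move=> D D' adj O mO.
(* Pulling [O] back through the selection rule gives one event on noisy vectors, the same for both
   datasets. *)
pose A := @noisy_of R n k @^-1` (sel @^-1` O).
have mA : measurable A.
  rewrite -[A]setTI; apply: measurable_noisy_of => //.
  by rewrite -[X in measurable X]setTI; exact: hselm.
have outE (B : ('I_n -> R) * ('I_n -> R)) :
    plo_output N sel Z B.1 B.2 @^-1` O =
    [set w | A (fun j => Z j w + plo_shift N B j)].
  apply/seteqP.
  suff E w : plo_output N sel Z B.1 B.2 w =
      sel (noisy_of (fun j => Z j w + plo_shift N B j)).
    by split=> w; rewrite /A /preimage /= E.
  rewrite /plo_output /noisy_of; congr (sel (_, (_, _)));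
    by apply: eq_from_tnth => i; rewrite !tnth_mktuple addrC.
rewrite !outE.
have l0 j := plo_noise_scale_gt0 j ha he hlev.
apply: le_trans (laplace_shift hZind l0 hZlap (plo_shift N D) (plo_shift N D') mA) _.
by rewrite lee_wpmul2r// lee_fin ler_expR plo_shift_le.
Qed.
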